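(* Let $n\ge 1$. There is an involution $\phi$ on the set of improper noncrossing trees with $n$ edges such that, for every such tree $T$, the numbers of descents of $T$ and of $\phi(T)$ have opposite parity. Consequently $$e_n-o_n=t_n,$$ where $e_n$ (resp. $o_n$) is the number of noncrossing trees with $n$ edges having an even (resp. odd) number of descents, and $t_n$ is the number of proper noncrossing trees with $n$ edges.
   Context: A noncrossing tree with $n$ edges is a tree on the vertex set $\{1,\dots,n+1\}$, the vertices placed in counterclockwise order on a circle, with edges drawn as chords inside the circle that pairwise do not cross. It is rooted at vertex $1$. A descent is an edge $(i,j)$ with $i>j$ such that $i$ is the parent of $j$. Equivalently, a noncrossing tree is represented as a rooted plane tree in which each non-root vertex $j$ with parent $i$ is labeled $L$ if $i>j$ and $R$ if $i<j$; the root is unlabeled and all children of the root are labeled $R$. A child labeled $L$ is a ''left child'', a child labeled $R$ is a ''right child''; descents correspond to $L$-labeled vertices. A noncrossing tree is even if its number of descents is even, odd otherwise. If the tree is even, a non-root vertex $v$ is proper if it has an even number of left children and no right child; if the tree is odd, a non-root vertex $v$ is proper if it has an even number of right children and no left child. A noncrossing tree is proper if every non-root vertex is proper, and improper otherwise. *)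

(* Defs.v *)
From HB Require Import structures.
From mathcomp Require Import all_boot all_order all_algebra.

Set Implicit Arguments.
Unset Strict Implicit.
Unset Printing Implicit Defensive.

(* Vertices 1, ..., n+1 are represented by 0, ..., n in 'I_n.+1, so the root 1
   is ord0. A simple graph is its set of edges, an edge being a two-element set
   of vertices. *)
Section Graphs.
Variable n : nat.
Implicit Types (E : {set {set 'I_n.+1}}) (x y i j : 'I_n.+1).

Definition simple_graph E : bool := [forall A in E, #|A| == 2].

Definition adj E : rel 'I_n.+1 := fun x y => [set x; y] \in E.

Definition connected E : bool := [forall x, forall y, connect (adj E) x y].

(* A duplicate-free sequence of vertices has at most n+1 items, so the bound on
   the length of the cycle is harmless; see acyclicP. *)
Definition acyclic E : bool :=
  [forall k : 'I_n.+2, forall c : k.-tuple 'I_n.+1,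
     (2 < k) ==> ~~ ucycleb (adj E) c].

Definition is_tree E : bool := [&& simple_graph E, connected E & acyclic E].

(* Two chords of the circle cross iff their endpoints strictly interleave. *)
Definition noncrossing E : bool :=
  [forall a : 'I_n.+1, forall b : 'I_n.+1,
   forall c : 'I_n.+1, forall d : 'I_n.+1,
     [&& a < c, c < b & b < d] ==> ~~ (adj E a b && adj E c d)].

Definition noncrossing_tree E : bool := is_tree E && noncrossing E.

(* i immediately precedes j on a simple path root, p, j; again the length bound
   is harmless, see parentP. *)
Definition parent E i j : bool :=
  [exists k : 'I_n.+1, exists p : k.-tuple 'I_n.+1,
     [&& path (adj E) ord0 (rcons p j), uniq (ord0 :: rcons p j)
       & last ord0 p == i]].

Lemma acyclicP E :
  reflect (forall c : seq 'I_n.+1, 2 < size c -> ~ ucycle (adj E) c)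
          (acyclic E).
Proof.
apply: (iffP forallP) => [acE c c_gt2 cE | acE k].
  have /andP[_ Uc] := cE.
  have c_lt : size c < n.+2.
    by rewrite ltnS -[X in _ <= X]card_ord -(card_uniqP Uc) max_card.
  have /forallP/(_ (in_tuple c))/implyP/(_ c_gt2)/negP := acE (Ordinal c_lt).
  exact.
apply/forallP=> c; apply/implyP=> k_gt2; apply/negP; apply: acE.
by rewrite size_tuple.
Qed.

Lemma parentP E i j :
  reflect (exists p : seq 'I_n.+1,
             [/\ path (adj E) ord0 (rcons p j), uniq (ord0 :: rcons p j)
               & last ord0 p = i])
          (parent E i j).
Proof.
apply: (iffP existsP) => [[k /existsP[p /and3P[pE Up /eqP pi]]] | [p [pE Up pi]]].
  by exists p.
have p_lt : size p < n.+1.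
  have := max_card (mem (ord0 :: rcons p j)).
  by rewrite (card_uniqP Up) card_ord /= size_rcons => /ltnW.
exists (Ordinal p_lt); apply/existsP; exists (in_tuple p).
by rewrite pE Up pi eqxx.
Qed.

End Graphs.

Record nctree (n : nat) := NCTree {
  edges :> {set {set 'I_n.+1}};
  edgesP : noncrossing_tree edges
}.

HB.instance Definition _ n := [isSub for @edges n].
HB.instance Definition _ n := [Finite of nctree n by <:].

Section Descents.
Variables (n : nat) (T : nctree n).
Implicit Types v : 'I_n.+1.

Definition descents : {set 'I_n.+1 * 'I_n.+1} :=
  [set p | parent T p.1 p.2 && (p.2 < p.1)].

Definition left_children v : {set 'I_n.+1} := [set w | parent T v w && (w < v)].

Definition right_children v : {set 'I_n.+1} := [set w | parent T v w && (v < w)].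

Definition even_tree : bool := ~~ odd #|descents|.

Definition odd_tree : bool := odd #|descents|.

Definition proper_vertex v : bool :=
  if even_tree then ~~ odd #|left_children v| && (right_children v == set0)
  else ~~ odd #|right_children v| && (left_children v == set0).

Definition proper_tree : bool := [forall v, (v != ord0) ==> proper_vertex v].

Definition improper_tree : bool := ~~ proper_tree.

End Descents.

Definition num_even (n : nat) : nat := #|[set T : nctree n | even_tree T]|.

Definition num_odd (n : nat) : nat := #|[set T : nctree n | odd_tree T]|.

Definition num_proper (n : nat) : nat := #|[set T : nctree n | proper_tree T]|.

(* Main.v *)
(** Call a non-root vertex bad if it has a right child or an odd number of left
children. A tree without bad vertices has an even number of descents, and an odd
tree is never proper, so a tree is improper iff it has a bad vertex. In an
improper tree take the bad vertex [v] of least depth, and of least label among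
those. If [v] has an odd number of left children, turn its nearest left child
[w] into a right child; otherwise turn its nearest right child [w] into a left
child. The descendants of [w] form an interval adjacent to [v], so this amounts
to sliding [v] across that interval, which relabels the vertices without
creating a crossing. Only the edge [{v, w}] changes direction; the badness and
the depth of every vertex are kept, and the order only changes between [v] and
deeper vertices, so that the same [v] and [w] are selected again and the move
undoes itself. *)

Require Import Defs.
From mathcomp Require Import all_boot all_order all_algebra.
From mathcomp Require Import zify.

Set Implicit Arguments.
Unset Strict Implicit.
Unset Printing Implicit Defensive.

(** * Intervals between two labels, and unordered pairs *)

Definition between (a b x : nat) : bool := (a < x < b) || (b < x < a).

Lemma between0 a b : between a b 0 = false.
Proof. by rewrite /between !ltn0. Qed.

Lemma betweenl a b : between a b a = false.
Proof. by rewrite /between !ltnn andbF. Qed.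

Lemma betweenr a b : between a b b = false.
Proof. by rewrite /between !ltnn andbF. Qed.

Lemma set2_eq (T : finType) (x y v w : T) :
  [set x; y] = [set v; w] -> (x = v /\ y = w) \/ (x = w /\ y = v).
Proof.
move=> /setP eq_xy.
have := eq_xy x; have := eq_xy y; have := eq_xy v; have := eq_xy w.
rewrite !inE !eqxx ?orbT /= => /orP[]/eqP-> /orP[]/eqP-> /esym/orP[]/eqP ? /esym/orP[]/eqP ?; subst; tauto.
Qed.

(** * Trees: cutting an edge, parents, intervals of descendants, depth *)

Section TreeTheory.
Variable n : nat.
Implicit Types (E : {set {set 'I_n.+1}}) (x y v w : 'I_n.+1).

Lemma adjC E : symmetric (adj E).
Proof. by move=> x y; rewrite /adj setUC. Qed.

Lemma connect_adjC E : connect_sym (adj E).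
Proof. exact/sym_connect_sym/adjC. Qed.

Lemma adj_neq E x y : simple_graph E -> adj E x y -> x != y.
Proof.
move=> /forall_inP sE; rewrite /adj => /sE; rewrite cards2.
by case: (x != y).
Qed.

Lemma adj_cut E v w x y :
  adj (E :\ [set v; w]) x y = ([set x; y] != [set v; w]) && adj E x y.
Proof. by rewrite /adj in_setD1. Qed.

(* When [v] is the parent of [w] in a tree, [below E v w] is the set of
   descendants of [w], including [w]. *)
Definition below E v w x : bool := connect (adj (E :\ [set v; w])) w x.

Lemma below_refl E v w : below E v w w.
Proof. exact: connect0. Qed.

Lemma below_cut E v w x y :
  adj (E :\ [set v; w]) x y -> below E v w x = below E v w y.
Proof.
by move=> xy; apply: (same_connect_r (@connect_adjC _) (connect1 xy)).
Qed.

(** Deleting [{v, w}] separates the ends of no other edge; this is the case split used whenever an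
    edge of [E] is compared with the cut. *)
Lemma below_adj E v w x y : adj E x y ->
  [\/ x = v /\ y = w, x = w /\ y = v | below E v w x = below E v w y].
Proof.
move=> xy; have [/set2_eq[] | ne] := eqVneq [set x; y] [set v; w].
- by constructor 1.
- by constructor 2.
by constructor 3; apply: below_cut; rewrite adj_cut ne.
Qed.

(** A simple path from [v] to [w] avoiding the edge that joins them would close up with it to a
    cycle of at least three vertices. *)
Lemma bridge E v w : is_tree E -> adj E v w -> ~~ below E v w v.
Proof.
case/and3P=> sE _ /acyclicP acE vw; apply/negP; rewrite /below connect_adjC.
case/connectP=> p0 p0E wE; move: wE; case/shortenP: p0E => p pE Up _ wE.
have pE' : path (adj E) v p.
  by apply: sub_path pE => x y; rewrite adj_cut => /andP[].
apply: (acE (v :: p)); last first.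
  by apply/andP; split=> //=; rewrite rcons_path pE' -wE adjC.
case: p pE wE {Up pE'} => [|a [|b p]] //= pE wE.
  by move: (adj_neq sE vw); rewrite wE eqxx.
by move: pE; rewrite -wE adj_cut eqxx.
Qed.

(** After the cut, the components of [v] and [w] have a union closed under adjacency in [E], so by
    connectedness they cover the tree. *)
Lemma connect_cutNbelow E v w x :
  is_tree E -> ~~ below E v w x -> connect (adj (E :\ [set v; w])) v x.
Proof.
case/and3P=> _ /forallP/(_ v)/forallP/(_ x) cvx _ Nwx.
pose a := [pred y | connect (adj (E :\ [set v; w])) v y || below E v w y].
have a_closed : closed (adj E) a.
  move=> y z yz; rewrite !inE.
  have [[-> ->]|[-> ->]|e] := below_adj v w yz.
  - by rewrite connect0 below_refl orbT.
  - by rewrite connect0 below_refl orbT.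
  have [/set2_eq[[-> ->]|[-> ->]]|ne] := eqVneq [set y; z] [set v; w];
    rewrite ?connect0 ?below_refl ?orbT //.
  rewrite e; congr (_ || _); apply: (same_connect_r (@connect_adjC _)).
  by rewrite connect1 // adj_cut ne.
have := closed_connect a_closed cvx.
by rewrite !inE connect0 (negPf Nwx) orbF => <-.
Qed.

Lemma connect_cut E v w x y : is_tree E ->
  ~~ below E v w x -> ~~ below E v w y ->
  connect (adj (E :\ [set v; w])) x y.
Proof.
move=> tE /(connect_cutNbelow tE) vx /(connect_cutNbelow tE) vy.
by apply: connect_trans vy; rewrite connect_adjC.
Qed.

(** A simple path from the root ending with the step from [v] to [w] survives the cut up to [v], so
    the root is on the side of [v]. Conversely, a simple path from the root to [v] in the cut graph
    cannot visit [w], and the edge extends it. *)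
Lemma parentE E v w : is_tree E ->
  parent E v w = adj E v w && ~~ below E v w ord0.
Proof.
move=> tE; apply/parentP/andP => [[p [pE Up pv]] | [vw N0]].
  move: pE; rewrite rcons_path pv => /andP[pE vw]; split=> //.
  apply: contra (bridge tE vw) => w0.
  apply: connect_trans w0 _; apply/connectP; exists p; last by rewrite pv.
  move: Up; rewrite -rcons_cons rcons_uniq => /andP[wp _].
  have pw : all (predC1 w) (ord0 :: p).
    by apply/allP => x xp /=; apply: contra wp => /eqP<-.
  apply: (sub_in_path _ pw pE) => x y /= xw yw xy; rewrite adj_cut xy andbT.
  by apply/eqP=> /set2_eq[[_ /eqP]|[/eqP]]; rewrite ?(negPf xw) ?(negPf yw).
have /connectP[p0 p0E vE] := connect_cut tE N0 (bridge tE vw).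
move: vE; case/shortenP: p0E => p pE Up _ vE; exists p; split=> //.
  rewrite rcons_path -vE vw andbT.
  by apply: sub_path pE => x y; rewrite adj_cut => /andP[].
rewrite -rcons_cons rcons_uniq Up andbT; apply/negP => wp.
case/splitPl: wp pE {Up vE} => p1 p2 lw; rewrite cat_path => /andP[p1E _].
case/negP: N0; rewrite /below connect_adjC; apply/connectP.
by exists p1.
Qed.

Lemma parent_adj E v w : is_tree E -> parent E v w -> adj E v w.
Proof. by move=> tE; rewrite parentE // => /andP[]. Qed.

Lemma parent_below E v w : is_tree E -> parent E v w -> ~~ below E v w ord0.
Proof. by move=> tE; rewrite parentE // => /andP[]. Qed.

Lemma parentNbelow E v w : is_tree E -> parent E v w -> ~~ below E v w v.
Proof. by move=> tE /(parent_adj tE); apply: bridge. Qed.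

(** This form of noncrossing needs no ordering of the endpoints and propagates along paths that
    avoid [s] and [t]. *)
Lemma between_adj E s t x y : noncrossing E -> adj E s t -> adj E x y ->
  x != s -> x != t -> y != s -> y != t -> between s t x = between s t y.
Proof.
have cross a b c d : noncrossing E -> adj E a b -> adj E c d ->
    a < c -> c < b -> b < d -> False.
  move=> /'forall_forallP/(_ a b)/'forall_forallP/(_ c d) ncE ab cd ac cb bd.
  by move: ncE; rewrite ac cb bd ab cd.
move=> ncE st xy; rewrite -!val_eqE /= => xs xt ys yt.
have ts : adj E t s by rewrite adjC.
have yx : adj E y x by rewrite adjC.
apply/idP/idP; rewrite /between => bx; apply/negPn/negP => Nb.
- have [/andP[sx xt']|/andP[tx xs']] := orP bx.
    have [yls|tly] : y < s \/ t < y by lia.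
      exact: (cross y x s t).
    exact: (cross s t x y).
  have [ylt|sly] : y < t \/ s < y by lia.
    exact: (cross y x t s).
  exact: (cross t s x y).
have [/andP[sy yt']|/andP[ty ys']] := orP bx.
  have [yls|tly] : x < s \/ t < x by lia.
    exact: (cross x y s t).
  exact: (cross s t y x).
have [ylt|sly] : x < t \/ s < x by lia.
  exact: (cross x y t s).
exact: (cross t s y x).
Qed.

Lemma between_path E s t x p : noncrossing E -> adj E s t ->
  path (adj E) x p -> s \notin x :: p -> t \notin x :: p ->
  between s t x = between s t (last x p).
Proof.
move=> ncE st; elim: p x => //= y p IH x /andP[xy pE].
rewrite in_cons negb_or eq_sym => /andP[xs sp].
rewrite in_cons negb_or eq_sym => /andP[xt tp].
rewrite -IH //; apply: (between_adj ncE st xy) => //.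
  by apply: contraNneq sp => <-; rewrite mem_head.
by apply: contraNneq tp => <-; rewrite mem_head.
Qed.

(* If [y] escaped the interval, the block and its complement would be two
   connected sets interleaving at [ord0 < x < y < z], hence would cross. *)
Lemma below_interval E v w x y z : noncrossing_tree E -> parent E v w ->
  below E v w x -> below E v w z -> x < y -> y < z -> below E v w y.
Proof.
case/andP=> tE ncE pvw bx bz xy yz; apply/negPn/negP => Ny.
have N0 := parent_below tE pvw.
have x_gt0 : 0 < x.
  by rewrite lt0n; apply: contraNneq N0 => x0; rewrite (_ : ord0 = x) //; apply: val_inj.
have sepP s t : below E v w s -> below E v w t -> adj (E :\ [set v; w]) s t ->
    between 0 y s = between 0 y t.
  move=> bs bt st; have {}st : adj E s t by move: st; rewrite adj_cut => /andP[].
  have ne (a b : 'I_n.+1) : ~~ below E v w a -> below E v w b -> a != b :> nat.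
    by move=> Na bb; rewrite val_eqE; apply: contraNneq Na => ->.
  pose a := [pred u | ~~ below E v w u && between s t u].
  have a_closed : closed (adj (E :\ [set v; w])) a.
    move=> g h gh; rewrite !inE (below_cut gh).
    case bh: (below E v w h) => //=; have /negbT Nh := bh.
    have Ng : ~~ below E v w g by rewrite (below_cut gh).
    move: gh; rewrite adj_cut => /andP[_ gh].
    by apply: (between_adj ncE st gh); rewrite -val_eqE /= ne.
  have := closed_connect a_closed (connect_cut tE N0 Ny).
  rewrite !inE N0 Ny /= /between.
  move: (ne _ _ N0 bs) (ne _ _ N0 bt) (ne _ _ Ny bs) (ne _ _ Ny bt) => /=; lia.
pose a := [pred u | below E v w u && between 0 y u].
have a_closed : closed (adj (E :\ [set v; w])) a.
  move=> g h gh; rewrite !inE (below_cut gh).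
  case bh: (below E v w h) => //=; apply: sepP => //.
  by rewrite (below_cut gh).
have xz : connect (adj (E :\ [set v; w])) x z.
  by apply: connect_trans bz; rewrite connect_adjC.
have := closed_connect a_closed xz.
rewrite !inE bx bz /between /=; lia.
Qed.

(** The root is never strictly between two labels, so the path from the root to [y], which avoids
    [w], must pass through [v] to get under the chord; the vertex after [v] on it is the child
    sought. *)
Lemma closer_child E v w y : noncrossing_tree E -> parent E v w -> v != ord0 ->
  between v w y -> ~~ below E v w y ->
  exists2 u, parent E v u & between v w u.
Proof.
case/andP=> tE ncE pvw v0 by_ Ny.
have N0 := parent_below tE pvw; have vw := parent_adj tE pvw.
have /connectP[p0 p0E yE] := connect_cut tE N0 Ny.
move: yE; case/shortenP: p0E => p pE Up _ yE.
have wp : w \notin ord0 :: p.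
  apply/negP => wp; case/splitPl: wp pE {Up yE} => p1 p2 lw.
  rewrite cat_path => /andP[p1E _]; case/negP: N0.
  by rewrite /below connect_adjC; apply/connectP; exists p1.
have {}pE : path (adj E) ord0 p.
  by apply: sub_path pE => a b; rewrite adj_cut => /andP[].
have vp : v \in p.
  apply/negPn/negP => vp.
  have := between_path ncE vw pE; rewrite -yE by_ in_cons (negPf v0) vp wp.
  by rewrite between0 => /(_ isT isT).
case/splitPr: vp Up pE yE wp => p1 [|u p2] Up pE yE wp.
  by move: by_; rewrite yE last_cat /= betweenl.
move: pE; rewrite cat_path /= => /and4P[p1E p1v vu p2E].
exists u.
  apply/parentP; exists (rcons p1 v); split; last by rewrite last_rcons.
    by rewrite !rcons_path p1E p1v last_rcons.
  move: Up; rewrite -cat_cons -cat_rcons -cat_rcons cat_uniq => /andP[].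
  by rewrite !rcons_cons.
rewrite (between_path ncE vw p2E); first by move: yE; rewrite last_cat /= => <-.
  move: Up; rewrite -cat_cons cat_uniq /= => /and3P[_ _ /and3P[vp2 _ _]].
  by move: vp2; rewrite in_cons.
by apply: contra wp => wp; rewrite in_cons mem_cat in_cons wp !orbT.
Qed.

Definition reach E k x : bool :=
  [exists p : k.-tuple 'I_n.+1, path (adj E) ord0 p && (last ord0 p == x)].

(** The length of a shortest walk from the root, with default [n.+1]. Being stated through walks, it
    is preserved by every bijective relabelling that fixes the root. *)
Definition depth E x : nat := find (fun k => reach E k x) (iota 0 n.+1).

Lemma reachP E k x :
  reflect (exists p, [/\ path (adj E) ord0 p, last ord0 p = x & size p = k])
    (reach E k x).
Proof.
apply: (iffP existsP) => [[p /andP[pE /eqP px]] | [p [pE px pk]]].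
  by exists p; rewrite size_tuple.
by rewrite -pk; exists (in_tuple p); rewrite pE px eqxx.
Qed.

Lemma depth_le E k x : reach E k x -> depth E x <= k.
Proof.
move=> kx; have [k_le|k_gt] := leqP n.+1 k.
  by apply: leq_trans k_le; rewrite -[X in _ <= X](size_iota 0) find_size.
rewrite leqNgt; apply/negP => /(before_find 0).
by rewrite nth_iota // add0n kx.
Qed.

Lemma reach_depth E x : is_tree E -> reach E (depth E x) x.
Proof.
case/and3P=> _ /forallP/(_ ord0)/forallP/(_ x)/connectP[p0 p0E xE] _.
move: xE; case/shortenP: p0E => p pE Up _ xE.
(* A duplicate-free path has at most [n] edges, so the search defining [depth] succeeds. *)
have p_lt : size p < n.+1.
  have := max_card (mem (ord0 :: p)).
  by rewrite (card_uniqP Up) card_ord.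
have hr : has (fun k => reach E k x) (iota 0 n.+1).
  apply/hasP; exists (size p); first by rewrite mem_iota.
  by apply/reachP; exists p.
have := nth_find 0 hr; rewrite nth_iota ?add0n //.
by rewrite -[X in _ < X](size_iota 0) -has_find.
Qed.

Lemma path_below E v w x p : parent E v w -> is_tree E ->
  path (adj E) x p -> ~~ below E v w x -> below E v w (last x p) ->
  exists p1 p2, p = p1 ++ w :: p2 /\ last x p1 = v.
Proof.
move=> pvw tE; elim: p x => [|y p IH] x /=; first by move=> _ /negP.
move=> /andP[xy pE] Nx by_.
have [bY|Ny] := boolP (below E v w y).
  have [[-> ->]|[xw _]|e] := below_adj v w xy.
  - by exists [::], p.
  - by rewrite xw below_refl in Nx.
  by rewrite e bY in Nx.
have [p1 [p2 [-> lv]]] := IH _ pE Ny by_.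
by exists (y :: p1), p2.
Qed.

(** A walk from the root to a descendant of [w] crosses from [v] to [w]; stopping it at [v] leaves a
    strictly shorter walk. *)
Lemma depth_below E v w x : is_tree E -> parent E v w -> below E v w x ->
  depth E v < depth E x.
Proof.
move=> tE pvw bx; have /reachP[p [pE px <-]] := reach_depth x tE.
rewrite -px in bx.
have [p1 [p2 [pq lv]]] := path_below pvw tE pE (parent_below tE pvw) bx.
rewrite pq size_cat /= addnS ltnS.
apply: (@leq_trans (size p1)); last exact: leq_addr.
apply: depth_le; apply/reachP; exists p1; split=> //.
by move: pE; rewrite pq cat_path => /andP[].
Qed.

End TreeTheory.

(** * Transport of trees along a bijective relabelling *)

Section Relabel.
Variable n : nat.
Implicit Types (f g : 'I_n.+1 -> 'I_n.+1) (E : {set {set 'I_n.+1}}).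
Implicit Types (x y v w : 'I_n.+1).

Definition relabel f E : {set {set 'I_n.+1}} :=
  [set f @: (A : {set 'I_n.+1}) | A in E].

Lemma relabelK f g E : cancel f g -> relabel g (relabel f E) = E.
Proof.
move=> fK; rewrite /relabel -imset_comp -[RHS]imset_id; apply: eq_imset => A /=.
by rewrite -imset_comp -[RHS]imset_id; apply: eq_imset => x /=.
Qed.

Lemma imset_set2 f x y : f @: [set x; y] = [set f x; f y].
Proof. by rewrite imsetU !imset_set1. Qed.

Lemma adj_relabel f E x y : injective f ->
  adj (relabel f E) (f x) (f y) = adj E x y.
Proof.
by move=> f_inj; rewrite /adj -imset_set2 mem_imset //; apply: imset_inj.
Qed.

Lemma path_relabel f E x p : injective f ->
  path (adj (relabel f E)) (f x) (map f p) = path (adj E) x p.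
Proof.
by move=> f_inj; elim: p x => //= y p IH x; rewrite adj_relabel // IH.
Qed.

Lemma relabel_cut f E v w : injective f ->
  relabel f E :\ [set f v; f w] = relabel f (E :\ [set v; w]).
Proof.
move=> f_inj; apply/setP=> A; rewrite in_setD1; apply/andP/imsetP.
  case=> Avw /imsetP[B BE AB]; exists B => //; rewrite in_setD1 BE andbT.
  by apply: contraNneq Avw => Bvw; rewrite AB Bvw imset_set2.
case=> B; rewrite in_setD1 => /andP[Bvw BE] ->; split; last exact: imset_f.
by rewrite -(imset_set2 f) (inj_eq (imset_inj f_inj)).
Qed.

Section Bijection.
Variables f g : 'I_n.+1 -> 'I_n.+1.
Hypotheses (fK : cancel f g) (gK : cancel g f).
Let f_inj : injective f := can_inj fK.
Let g_inj : injective g := can_inj gK.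

Lemma connect_relabel E x y :
  connect (adj (relabel f E)) (f x) (f y) = connect (adj E) x y.
Proof.
apply/connectP/connectP => -[p pE yE]; last first.
  by exists (map f p); rewrite ?path_relabel // last_map -yE.
exists (map g p); last by apply: f_inj; rewrite -(last_map f) mapK.
by rewrite -(path_relabel E _ _ f_inj) mapK.
Qed.

Lemma below_relabel E v w x :
  below (relabel f E) (f v) (f w) (f x) = below E v w x.
Proof. by rewrite /below relabel_cut // connect_relabel. Qed.

Lemma is_tree_relabel E : is_tree E -> is_tree (relabel f E).
Proof.
case/and3P=> /forall_inP sE /'forall_forallP cE /acyclicP acE.
apply/and3P; split.
- apply/forall_inP=> A /imsetP[B /sE BE ->]; rewrite card_imset //.
- apply/'forall_forallP=> x y; rewrite -(gK x) -(gK y) connect_relabel.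
  exact: cE.
apply/acyclicP=> c c_gt2 /andP[cE' Uc].
apply: (acE (map g c)); first by rewrite size_map.
apply/andP; split; last by rewrite map_inj_uniq.
case: c cE' {Uc c_gt2} => //= x c.
by rewrite -(path_relabel E _ _ f_inj) map_rcons mapK // gK.
Qed.

Hypothesis f0 : f ord0 = ord0.

Lemma parent_relabel E x y : parent (relabel f E) (f x) (f y) = parent E x y.
Proof.
apply/parentP/parentP => -[p [pE Up px]].
  exists (map g p); split.
  - by rewrite -(path_relabel E _ _ f_inj) map_rcons mapK // f0.
  - by rewrite -(map_inj_uniq f_inj) /= map_rcons mapK // f0.
  by apply: f_inj; rewrite -px -(last_map f) mapK // f0.
exists (map f p); split.
- by rewrite -map_rcons -f0 path_relabel.
- by rewrite -map_rcons -f0 -map_cons map_inj_uniq.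
by rewrite -f0 last_map px.
Qed.

Lemma depth_relabel E x : depth (relabel f E) (f x) = depth E x.
Proof.
apply: eq_find => k; apply/reachP/reachP => -[p [pE px pk]].
  exists (map g p); split; last by rewrite size_map.
  - by rewrite -(path_relabel E _ _ f_inj) mapK // f0.
  by apply: f_inj; rewrite -px -(last_map f) mapK // f0.
exists (map f p); split; last by rewrite size_map.
- by rewrite -f0 path_relabel.
by rewrite -f0 last_map px.
Qed.

End Bijection.
End Relabel.

(** * Arithmetic of the cyclic shift *)

Definition sweep (v c x : nat) : bool := (v < x <= c) || (c <= x < v).

Lemma sweepl v c : sweep v c v = false.
Proof. by rewrite /sweep ltnn andbF. Qed.

(* The cyclic relabelling that moves [v] to the far end [c] of [sweep v c] and
   slides the points of [sweep v c] one step towards [v]. *)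
Definition shift (v c x : nat) : nat :=
  if x == v then c
  else if v < x <= c then x.-1
  else if c <= x < v then x.+1 else x.

(** The cases in a form suited to [lia]; the decrement is written as a successor on the other side,
    which avoids truncated subtraction. *)
Lemma shiftP v c x :
  x = v /\ shift v c x = c \/
  v < x <= c /\ x = (shift v c x).+1 \/
  c <= x < v /\ shift v c x = x.+1 \/
  x <> v /\ ~~ (v < x <= c) /\ ~~ (c <= x < v) /\ shift v c x = x.
Proof.
by rewrite /shift; case: eqP => ?; last case: ifP; last case: ifP; lia.
Qed.

Lemma shiftK v c x : shift c v (shift v c x) = x.
Proof. by have := shiftP v c x; have := shiftP c v (shift v c x); lia. Qed.

Lemma sweep_shift v c x : sweep c v (shift v c x) = sweep v c x.
Proof. by have := shiftP v c x; rewrite /sweep; lia. Qed.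

Lemma shift_out v c x : x != v -> ~~ sweep v c x -> shift v c x = x.
Proof. by have := shiftP v c x; rewrite /sweep; lia. Qed.

Lemma shift_lt v c x y : sweep v c x = sweep v c y ->
  (shift v c x < shift v c y) = (x < y).
Proof. by have := shiftP v c x; have := shiftP v c y; rewrite /sweep; lia. Qed.

Lemma shift_lt_sweep v c w : sweep v c w ->
  (shift v c w < shift v c v) = ~~ (w < v) /\
  (shift v c v < shift v c w) = (w < v).
Proof. by have := shiftP v c w; have := shiftP v c v; rewrite /sweep; lia. Qed.

Lemma shift_id v c : shift v c v = c.
Proof. by rewrite /shift eqxx. Qed.

Lemma sweep_leq_out v c w x : sweep v c w -> x != v -> ~~ sweep v c x ->
  v <= x -> c <= x.
Proof. by rewrite /sweep; lia. Qed.

Lemma between_shift_out v c w x : sweep v c w -> x != v -> ~~ sweep v c x ->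
  between c (shift v c w) x = false.
Proof. by have := shiftP v c w; rewrite /sweep /between; lia. Qed.

(** Two edges other than [{v, w}] keep their relative order if they are on the same side of the
    sweep, and cannot interleave otherwise, as the image of the sweep is an interval. An edge
    crossing the image of [{v, w}] would have an end strictly between the two new labels, hence both
    ends in the sweep, where the order relative to [w] is unchanged. *)
Lemma shift_crossing v c w x y z t : sweep v c w ->
  x = v /\ y = w \/ x = w /\ y = v \/ sweep v c x = sweep v c y ->
  z = v /\ t = w \/ z = w /\ t = v \/ sweep v c z = sweep v c t ->
  between x y z = between x y t ->
  shift v c x < shift v c z -> shift v c z < shift v c y ->
  shift v c y < shift v c t -> False.
Proof.
move=> aw xy zt.
have := sweep_shift v c x; have := sweep_shift v c y.
have := sweep_shift v c z; have := sweep_shift v c t.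
have := @shift_lt v c x z; have := @shift_lt v c z y; have := @shift_lt v c y t.
case: xy zt => [[-> ->]|[[-> ->]|xy]] [[-> ->]|[[-> ->]|zt]].
- lia.
- lia.
- rewrite shift_id aw.
  move: (shift v c w) (shift v c z) (shift v c t) => W Z T.
  by rewrite /sweep /between in aw zt *; lia.
- lia.
- lia.
- rewrite shift_id aw.
  move: (shift v c w) (shift v c z) (shift v c t) => W Z T.
  by rewrite /sweep /between in aw zt *; lia.
- rewrite shift_id aw.
  move: (shift v c w) (shift v c x) (shift v c y) => W X Y.
  by rewrite /sweep /between in aw xy *; lia.
- rewrite shift_id aw.
  move: (shift v c w) (shift v c x) (shift v c y) => W X Y.
  by rewrite /sweep /between in aw xy *; lia.
move: (shift v c x) (shift v c y) (shift v c z) (shift v c t) => X Y Z T.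
rewrite -zt -xy; case ax: (sweep v c x); case az: (sweep v c z);
  rewrite /sweep /between in ax az *; lia.
Qed.

Lemma odd_card_toggle (T : finType) (A B : {set T}) a :
  (forall x, x != a -> (x \in A) = (x \in B)) -> (a \in A) = ~~ (a \in B) ->
  odd #|A| = ~~ odd #|B|.
Proof.
move=> AB aAB; rewrite (cardsD1 a A) (cardsD1 a B) aAB.
have -> : A :\ a = B :\ a.
  by apply/setP=> x; rewrite !in_setD1; case: eqVneq => //= xa; apply: AB.
by rewrite !oddD !oddb addNb.
Qed.

(** * Sliding a vertex across a block of descendants; choice of the vertex and of the block *)

Section Surgery.
Variable n : nat.
Implicit Types (E : {set {set 'I_n.+1}}) (T : nctree n) (x y u v w c : 'I_n.+1).

Definition oshift v c x : 'I_n.+1 := inord (shift v c x).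

Lemma val_oshift v c x : oshift v c x = shift v c x :> nat.
Proof.
rewrite inordK //.
by have := shiftP v c x; have := ltn_ord v; have := ltn_ord x; have := ltn_ord c; lia.
Qed.

Lemma oshiftK v c : cancel (oshift v c) (oshift c v).
Proof. by move=> x; apply: val_inj; rewrite /= !val_oshift shiftK. Qed.

Lemma oshift_inj v c : injective (oshift v c).
Proof. exact: can_inj (@oshiftK v c). Qed.

Lemma oshift_id v c : oshift v c v = c.
Proof. by apply: val_inj; rewrite /= val_oshift shift_id. Qed.

Lemma nctree_tree T : is_tree T.
Proof. by have /andP[] := edgesP T. Qed.

Lemma parent_asym E v w : is_tree E -> parent E v w -> ~~ parent E w v.
Proof.
move=> tE /(parent_below tE) Nw; apply/negP => /(parent_below tE).
by rewrite /below setUC (connect_cutNbelow tE Nw).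
Qed.

(** Here [c] is the end farthest from [v] of the interval of descendants of [w], so that [sweep v c]
    is exactly what [v] crosses on its way to position [c]. *)
Definition block E v w c : Prop :=
  [/\ parent E v w, v != ord0 & forall x, below E v w x = sweep v c x].

Section Block.
Variables (E : {set {set 'I_n.+1}}) (v w c : 'I_n.+1).
Hypotheses (tE : is_tree E) (vwc : block E v w c).
Let pvw : parent E v w. Proof. by case: vwc. Qed.
Let v_neq0 : v != ord0. Proof. by case: vwc. Qed.
Let belowE x : below E v w x = sweep v c x. Proof. by case: vwc. Qed.
Let sweep_w : sweep v c w. Proof. by rewrite -belowE below_refl. Qed.

Lemma oshift0 : oshift v c ord0 = ord0.
Proof.
apply: val_inj; rewrite /= val_oshift shift_out //.
  by rewrite eq_sym; apply: v_neq0.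
by have := parent_below tE pvw; rewrite belowE.
Qed.

Lemma sweep_adj x y : adj E x y ->
  [\/ x = v /\ y = w, x = w /\ y = v | sweep v c x = sweep v c y].
Proof. by rewrite -!belowE; apply: below_adj. Qed.

Lemma parent_oshift x y :
  parent (relabel (oshift v c) E) (oshift v c x) (oshift v c y) = parent E x y.
Proof. exact: (parent_relabel (@oshiftK v c) (@oshiftK c v) oshift0). Qed.

Lemma noncrossing_oshift : noncrossing E -> noncrossing (relabel (oshift v c) E).
Proof.
move=> ncE; apply/'forall_forallP=> a b; apply/'forall_forallP=> a' b'.
rewrite -(oshiftK c v a) -(oshiftK c v b) -(oshiftK c v a') -(oshiftK c v b').
move: (oshift c v a) (oshift c v b) (oshift c v a') (oshift c v b') => {a b a' b'} x y z t.
rewrite !(adj_relabel _ _ _ (@oshift_inj v c)) !val_oshift.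
apply/implyP=> /and3P[xz zy yt]; apply/negP=> /andP[xy zt].
have ne (p q : 'I_n.+1) : shift v c p < shift v c q -> p != q.
  by apply: contraTneq => ->; rewrite ltnn.
have btw : between x y z = between x y t.
  apply: (between_adj ncE xy zt).
  - by rewrite eq_sym ne.
  - by rewrite ne.
  - by rewrite eq_sym ne // (ltn_trans xz) // (ltn_trans zy).
  by rewrite eq_sym ne.
have edge p q : adj E p q -> p = v :> nat /\ q = w :> nat \/
    p = w :> nat /\ q = v :> nat \/ sweep v c p = sweep v c q.
  by case/sweep_adj=> [[-> ->]|[-> ->]|->]; tauto.
exact: (shift_crossing sweep_w (edge _ _ xy) (edge _ _ zt) btw xz zy yt).
Qed.

(** Any other edge has both ends in the sweep or both outside it, and the shift is increasing on
    each of these two sets. *)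
Lemma oshift_lt_parent x y : parent E x y -> (x, y) != (v, w) ->
  (oshift v c x < oshift v c y) = (x < y) /\
  (oshift v c y < oshift v c x) = (y < x).
Proof.
move=> pxy ne; rewrite !val_oshift.
have [[xv yw]|[xw yv]|e] := sweep_adj (parent_adj tE pxy).
- by rewrite xv yw eqxx in ne.
- by move: (parent_asym tE pvw); rewrite -xw -yv pxy.
by split; apply: shift_lt.
Qed.

Lemma oshift_lt_child : (oshift v c w < oshift v c v) = ~~ (w < v) /\
  (oshift v c v < oshift v c w) = (w < v).
Proof. by rewrite !val_oshift; apply: shift_lt_sweep. Qed.

Lemma below_oshift x :
  below (relabel (oshift v c) E) c (oshift v c w) x = sweep c v x.
Proof.
have := below_relabel (@oshiftK v c) (@oshiftK c v) E v w (oshift c v x).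
by rewrite oshift_id (oshiftK c v) belowE val_oshift sweep_shift => ->.
Qed.

(** The data of the reverse move: the moved vertex is now called [c], and the far end of its block
    is the label [v] that it has vacated. *)
Lemma block_oshift : block (relabel (oshift v c) E) c (oshift v c w) v.
Proof.
split; last exact: below_oshift.
  by have := parent_oshift v w; rewrite oshift_id => ->.
by have := inj_eq (@oshift_inj v c) v ord0; rewrite oshift_id oshift0 => ->.
Qed.

End Block.

Lemma noncrossing_tree_oshift E v w c : noncrossing_tree E -> block E v w c ->
  noncrossing_tree (relabel (oshift v c) E).
Proof.
case/andP=> tE ncE vwc; apply/andP; split; last exact: noncrossing_oshift vwc ncE.
exact: (is_tree_relabel (@oshiftK v c) (@oshiftK c v)).
Qed.

(* Properness for even trees; an odd tree always has a bad vertex and is never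
   proper, so a tree is improper exactly when it has a bad vertex. *)
Definition bad T v : bool :=
  (v != ord0) && (odd #|left_children T v| || (right_children T v != set0)).

Lemma sum_left_children T : #|descents T| = \sum_v #|left_children T v|.
Proof.
rewrite -sum1_card (eq_bigl (fun p => parent T p.1 p.2 && (p.2 < p.1))); last first.
  by move=> p; rewrite inE.
rewrite -(pair_big_dep xpredT (fun x y => parent T x y && (y < x)) (fun _ _ => 1)) /=.
by apply: eq_bigr => v _; rewrite -sum1_card; apply: eq_bigl => w; rewrite inE.
Qed.

Lemma left_children_root T : left_children T ord0 = set0.
Proof. by apply/setP=> w; rewrite !inE ltn0 andbF. Qed.

Lemma even_treeNbad T : (forall v, ~~ bad T v) -> even_tree T.
Proof.
move=> Nb; rewrite /even_tree sum_left_children.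
apply: (big_ind (fun k => ~~ odd k)) => // [x y | v _].
  by rewrite oddD => /negPf-> /negPf->.
have := Nb v; rewrite /bad; case: eqVneq => [-> | _] /=.
  by rewrite left_children_root cards0.
by rewrite negb_or => /andP[].
Qed.

(** In an odd proper tree no non-root vertex would have a left child, and the root has none because
    its label is least; there would be no descent at all, an even number. *)
Lemma proper_tree_even T : proper_tree T -> even_tree T.
Proof.
move=> /forallP pT; have [//|oddT] := boolP (even_tree T).
suff : even_tree T by rewrite (negPf oddT).
rewrite /even_tree sum_left_children big1 // => v _.
have [->|v0] := eqVneq v ord0; first by rewrite left_children_root cards0.
have := pT v; rewrite v0 /proper_vertex (negPf oddT) => /andP[_ /eqP->].
exact: cards0.
Qed.

Lemma improper_bad T : improper_tree T = [exists v, bad T v].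
Proof.
have evenE : even_tree T -> improper_tree T = [exists v, bad T v].
  move=> evT; rewrite /improper_tree /proper_tree negb_forall.
  apply: eq_existsb => v; rewrite /proper_vertex evT /bad negb_imply negb_and.
  by rewrite negbK.
apply/idP/idP => [imp | bT]; last first.
  apply/negP=> pT; move: (evenE (proper_tree_even pT)).
  by rewrite bT /improper_tree pT.
have [/evenE<- //|] := boolP (even_tree T).
apply: contraR => /existsPn; exact: even_treeNbad.
Qed.

Definition first_bad T v : Prop := bad T v /\
  forall x, bad T x -> depth T v < depth T x \/ depth T v = depth T x /\ v <= x.

Lemma first_bad_exists T : improper_tree T -> exists v, first_bad T v.
Proof.
rewrite improper_bad => /existsP[v0 bv0].
(* Labels are below [n.+1], so this weight orders vertices by depth first and by label second. *)
case: (arg_minnP (fun x => depth T x * n.+1 + x) bv0) => v bv min_v.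
exists v; split=> // x /min_v.
have := ltn_ord v; have := ltn_ord x; case: (ltngtP (depth T v) (depth T x)).
- by left.
- move=> lt_d ltx ltv le_k; suff : depth T x * n.+1 + n.+1 <= depth T v * n.+1 by lia.
  by rewrite addnC -mulSn leq_mul2r lt_d orbT.
by move=> -> _ _; rewrite leq_add2l; right.
Qed.

Lemma first_bad_uniq T v v' : first_bad T v -> first_bad T v' -> v = v'.
Proof.
move=> [bv mv] [bv' mv']; apply: val_inj => /=.
by have := mv _ bv'; have := mv' _ bv; lia.
Qed.

(* The child to be moved across [v] is the child nearest to [v] on its left if
   [v] has an odd number of left children, on its right otherwise. *)
Definition pivot T v w c : Prop :=
  [/\ first_bad T v, block T v w c, (w < v) = odd #|left_children T v|
    & forall u, parent T v u -> ~~ between v w u].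

Lemma nearest_child T v : bad T v ->
  exists w, [/\ parent T v w, (w < v) = odd #|left_children T v|
              & forall u, parent T v u -> ~~ between v w u].
Proof.
case/andP=> v0; case: (boolP (odd _)) => [oddl _ | _ /= /set0Pn[w0]].
  have /set0Pn[w0] : left_children T v != set0.
    by apply: contraTneq oddl => ->; rewrite cards0.
  rewrite inE => w0l.
  case: (@arg_maxnP _ w0 (fun w => parent T v w && (w < v)) val w0l).
  move=> w /andP[pw wv] max_w; exists w; split=> // u pu; apply/negP=> bu.
  by have := max_w u; rewrite pu; move: bu; rewrite /between /=; lia.
rewrite inE => w0r.
case: (@arg_minnP _ w0 (fun w => parent T v w && (v < w)) val w0r).
move=> w /andP[pw wv] min_w; exists w; split=> //.
  by apply/negbTE; rewrite -leqNgt ltnW.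
move=> u pu; apply/negP=> bu.
by have := min_w u; rewrite pu; move: bu; rewrite /between /=; lia.
Qed.

(** By [closer_child] every label strictly between [v] and [w] is a descendant of [w]; with
    [below_interval] the descendants fill an interval adjacent to [v]. It does not contain [v], and
    [c] is its minimum or maximum according to the side of [w]. *)
Lemma block_exists E v w : noncrossing_tree E -> parent E v w -> v != ord0 ->
  (forall u, parent E v u -> ~~ between v w u) -> exists c, block E v w c.
Proof.
move=> ncT pvw v0 near; have /andP[tE ncE] := ncT.
have Nv := parentNbelow tE pvw.
have gap y : between v w y -> below E v w y.
  move=> bY; apply/negPn/negP => Ny.
  have [u pu bu] := closer_child ncT pvw v0 bY Ny.
  by case/negP: (near u pu).
have itv := below_interval ncT pvw.
have neq x : below E v w x -> x != v :> nat.
  by move=> bx; rewrite val_eqE; apply: contraTneq bx => ->.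
have bw := below_refl E v w.
have := neq w bw; rewrite neq_ltn => /orP[wv | vw].
  case: (@arg_minnP _ w (below E v w) val bw) => c bc min_c.
  exists c; split=> // x; apply/idP/idP => [bx | ].
    have [vx|xv] := ltnP v x; first by case/negP: Nv; apply: itv bw bx wv vx.
    by have := min_c _ bx; have := neq x bx; rewrite /sweep /=; lia.
  have := min_c _ bw; rewrite /sweep /= => cw; case/orP=> [|/andP[cx xv]]; first by lia.
  have [xw|wx|/val_inj->] := ltngtP x w; last exact: bw.
    have [cx'|] := ltnP c x; first exact: itv bc bw cx' xw.
    by move=> xc; rewrite (_ : x = c) //; apply: val_inj => /=; lia.
  by apply: gap; rewrite /between wx xv orbT.
case: (@arg_maxnP _ w (below E v w) val bw) => c bc max_c.
exists c; split=> // x; apply/idP/idP => [bx | ].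
  have [xv|vx] := ltnP x v; first by case/negP: Nv; apply: itv bx bw xv vw.
  by have := max_c _ bx; have := neq x bx; rewrite /sweep /=; lia.
have := max_c _ bw; rewrite /sweep /= => cw; case/orP=> [/andP[vx xc]|]; last by lia.
have [xw|wx|/val_inj->] := ltngtP x w; last exact: bw.
  by apply: gap; rewrite /between vx xw.
have [xc'|] := ltnP x c; first exact: itv bw bc wx xc'.
by move=> cx; rewrite (_ : x = c) //; apply: val_inj => /=; lia.
Qed.

Lemma pivot_exists T : improper_tree T -> exists v w c, pivot T v w c.
Proof.
case/first_bad_exists=> v fv; have bv : bad T v by case: fv.
have [w [pw sw near]] := nearest_child bv.
have [c vwc] : exists c, block T v w c.
  by apply: block_exists => //; [apply: edgesP | case/andP: bv].
by exists v, w, c.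
Qed.

(** The parity of the left children of [v] fixes the side of [w], and nearness then fixes [w].
    Finally [c] and [c'] are far ends of the same set of descendants. *)
Lemma pivot_uniq T v w c v' w' c' :
  pivot T v w c -> pivot T v' w' c' -> v = v' /\ c = c'.
Proof.
move=> [fv [pw v0 bc] sw near] [fv' [pw' _ bc'] sw' near'].
have v_eq := first_bad_uniq fv fv'; subst v'; split=> //.
have tT := nctree_tree T.
have w_eq : w = w'.
  apply: val_inj => /=; have := near _ pw'; have := near' _ pw; rewrite /between.
  have := adj_neq (proj1 (andP tT)) (parent_adj tT pw).
  have := adj_neq (proj1 (andP tT)) (parent_adj tT pw').
  by rewrite -!val_eqE /=; move: sw sw'; case: odd; lia.
subst w'; apply: val_inj => /=.
have aw : sweep v c w by rewrite -bc below_refl.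
have aw' : sweep v c' w by rewrite -bc' below_refl.
have : sweep v c' c by rewrite -bc' bc; rewrite /sweep in aw *; lia.
have : sweep v c c' by rewrite -bc bc'; rewrite /sweep in aw' *; lia.
by rewrite /sweep; lia.
Qed.

End Surgery.

(** * The parity-reversing involution and the count *)

Section Toggle.
Variable n : nat.

Section PivotMove.
Variables (T T' : nctree n) (v w c : 'I_n.+1).
Hypotheses (T'E : edges T' = relabel (oshift v c) T) (vwc : block T v w c).
Implicit Types x y u : 'I_n.+1.
Let f := oshift v c.
Let tT := nctree_tree T.
Let f_inj : injective f := @oshift_inj n v c.
Let fK x : f (oshift c v x) = x. Proof. exact: oshiftK. Qed.
Let fv : f v = c. Proof. exact: oshift_id. Qed.
Let pvw : parent T v w. Proof. by case: vwc. Qed.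
Let sweep_w : sweep v c w. Proof. by case: vwc => _ _ <-; apply: below_refl. Qed.

Lemma parent_move x y : parent T' (f x) (f y) = parent T x y.
Proof. by rewrite T'E (parent_oshift tT vwc). Qed.

Lemma left_children_move x :
  left_children T' (f x) = f @: [set y | parent T x y && (f y < f x)].
Proof.
by apply/setP=> y; rewrite -(fK y) mem_imset // !inE parent_move.
Qed.

Lemma right_children_move x :
  right_children T' (f x) = f @: [set y | parent T x y && (f x < f y)].
Proof.
by apply/setP=> y; rewrite -(fK y) mem_imset // !inE parent_move.
Qed.

(** Once vertices are named by their old labels, only the pair [(v, w)] enters or leaves the set of
    descents. *)
Lemma odd_descents_move : odd #|descents T'| = ~~ odd #|descents T|.
Proof.
have -> : descents T' = [set (f p.1, f p.2) | p in
    [set p : 'I_n.+1 * 'I_n.+1 | parent T p.1 p.2 && (f p.2 < f p.1)]].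
  apply/setP=> -[x y]; rewrite -(fK x) -(fK y).
  move: (oshift c v x) (oshift c v y) => {}x {}y.
  rewrite (mem_imset _ (x, y)) ?inE /= ?parent_move //.
  by move=> [a b] [a' b'] [/f_inj-> /f_inj->].
rewrite card_imset; last by move=> [a b] [a' b'] [/f_inj-> /f_inj->].
apply: (odd_card_toggle (a := (v, w))) => [[x y] ne|]; rewrite !inE /=.
  case pxy: (parent T x y) => //=.
  by have [_ ->] := oshift_lt_parent tT vwc pxy ne.
by have [-> _] := oshift_lt_child vwc; rewrite pvw.
Qed.

Lemma odd_left_children_move :
  odd #|left_children T' c| = ~~ odd #|left_children T v|.
Proof.
rewrite -fv left_children_move card_imset //.
apply: (odd_card_toggle (a := w)) => [y ne|]; rewrite !inE.
  case pxy: (parent T v y) => //=.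
  have vy : (v, y) != (v, w) by rewrite xpair_eqE eqxx.
  by have [_ ->] := oshift_lt_parent tT vwc pxy vy.
by have [-> _] := oshift_lt_child vwc; rewrite pvw.
Qed.

Lemma bad_move x : x != v -> bad T' (f x) = bad T x.
Proof.
move=> xv; rewrite /bad left_children_move right_children_move.
rewrite card_imset // imset_eq0 -{1}(oshift0 tT vwc) (inj_eq f_inj).
have lt_f y : parent T x y -> (f x < f y) = (x < y) /\ (f y < f x) = (y < x).
  move=> pxy; apply: (oshift_lt_parent tT vwc pxy).
  by rewrite xpair_eqE (negPf xv).
have -> : [set y | parent T x y && (f y < f x)] = left_children T x.
  by apply/setP=> y; rewrite !inE; case: (boolP (parent T x y)) => //= /lt_f[_ ->].
have -> : [set y | parent T x y && (f x < f y)] = right_children T x.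
  by apply/setP=> y; rewrite !inE; case: (boolP (parent T x y)) => //= /lt_f[-> _].
by [].
Qed.

(** This is what makes the move undo itself: the reverse data satisfy the same selection rule in the
    new tree. *)
Lemma pivot_move : pivot T v w c -> pivot T' c (f w) v.
Proof.
move=> [[bv min_v] _ sw near].
have [fwv fvw] := oshift_lt_child vwc.
have c0 : c != ord0.
  by rewrite -fv -(oshift0 tT vwc) (inj_eq f_inj); case: vwc.
have sw' : (f w < c) = odd #|left_children T' c|.
  by rewrite odd_left_children_move -sw -fv fwv.
have dE x : depth T' (f x) = depth T x.
  rewrite T'E (depth_relabel (@oshiftK n v c) (@oshiftK n c v)) //.
  exact: oshift0 tT vwc.
have [_ _ bE] := vwc.
(* If [c] now has evenly many left children, [v] had oddly many before, so [w] was a left child and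
   has become a right one. *)
have bc : bad T' c.
  rewrite /bad c0 /=; case: (boolP (odd _)) => //= Nodd.
  apply/set0Pn; exists (f w); rewrite inE -{1}fv parent_move pvw -fv.
  by rewrite fvw sw -[odd _]negbK -odd_left_children_move.
split=> //.
- split=> // x; rewrite -(fK x); move: (oshift c v x) => {}x bx.
  have [->|xv] := eqVneq x v; first by right; rewrite fv.
  rewrite bad_move // in bx; rewrite -{1 2}fv !dE.
  have [|[dvx vx]] := min_v _ bx; [by left | right; split=> //].
  (* A vertex at the depth of [v] is no descendant of [w], so [x] keeps its label; a label above [v]
     and outside the sweep is at least [c]. *)
  have Nx : ~~ sweep v c x.
    by rewrite -bE; apply/negP => /(depth_below tT pvw); rewrite dvx ltnn.
  by rewrite val_oshift shift_out //; apply: sweep_leq_out sweep_w xv Nx vx.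
- by rewrite T'E; apply: block_oshift.
move=> u; rewrite -(fK u) -{1}fv parent_move; move: (oshift c v u) => {}u pu.
have [->|uw] := eqVneq u w; first by rewrite betweenr.
have uv : u != v.
  by rewrite eq_sym; apply: (adj_neq (proj1 (andP tT)) (parent_adj tT pu)).
(* Children of [v] other than [w] lie outside the block and keep their labels, while all labels
   strictly between [c] and the new label of [w] belong to the shifted block. *)
have Nu : ~~ sweep v c u.
  have [[_ /eqP]|[/eqP]|] := sweep_adj vwc (parent_adj tT pu).
  - by rewrite (negPf uw).
  - by rewrite (negPf (adj_neq (proj1 (andP tT)) (parent_adj tT pvw))).
  by move=> <-; rewrite sweepl.
by rewrite !val_oshift (shift_out _ Nu) // (between_shift_out sweep_w uv Nu).
Qed.

Lemma improper_move : pivot T v w c -> improper_tree T'.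
Proof.
by case/pivot_move=> [[bc _] _ _ _]; rewrite improper_bad; apply/existsP; exists c.
Qed.

End PivotMove.

(** A relation rather than a function, since the pivot is only known to exist; it is shown total on
    improper trees, single-valued and symmetric, then turned into a map by finite choice. *)
Definition toggles (T T' : nctree n) : Prop :=
  exists v w c, pivot T v w c /\ edges T' = relabel (oshift v c) T.

Lemma toggles_exists T : improper_tree T -> exists T', toggles T T'.
Proof.
move=> /pivot_exists[v [w [c pT]]]; have [_ vwc _ _] := pT.
by exists (NCTree (noncrossing_tree_oshift (edgesP T) vwc)), v, w, c.
Qed.

Lemma toggles_sym T T' : toggles T T' -> toggles T' T.
Proof.
move=> [v [w [c [pT T'E]]]]; have [_ vwc _ _] := pT.
exists c, (oshift v c w), v; split; first exact: pivot_move pT.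
by rewrite T'E relabelK //; apply: oshiftK.
Qed.

Lemma toggles_fun T T1 T2 : toggles T T1 -> toggles T T2 -> T1 = T2.
Proof.
move=> [v [w [c [pT T1E]]]] [v' [w' [c' [pT' T2E]]]].
by apply: val_inj; rewrite /= T1E T2E; have [-> ->] := pivot_uniq pT pT'.
Qed.

Lemma toggles_improper T T' : toggles T T' -> improper_tree T'.
Proof.
move=> [v [w [c [pT T'E]]]]; have [_ vwc _ _] := pT.
exact: improper_move T'E vwc pT.
Qed.

Lemma toggles_odd T T' :
  toggles T T' -> odd #|descents T'| = ~~ odd #|descents T|.
Proof.
move=> [v [w [c [pT T'E]]]]; have [_ vwc _ _] := pT.
exact: odd_descents_move T'E vwc.
Qed.

Lemma toggle_exists :
  exists phi : {T : nctree n | improper_tree T} ->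
               {T : nctree n | improper_tree T},
    involutive phi /\
    forall T, odd #|descents (val (phi T))| = ~~ odd #|descents (val T)|.
Proof.
have [phi phiP] : exists phi : {T : nctree n | improper_tree T} ->
    {T : nctree n | improper_tree T}, forall T, toggles (val T) (val (phi T)).
  pose P (T T' : {T : nctree n | improper_tree T}) := toggles (val T) (val T').
  apply: (fin_all_exists (P := P)) => -[T impT]; have [T' TT'] := toggles_exists impT.
  by exists (Sub T' (toggles_improper TT')).
exists phi; split=> T; last exact: toggles_odd.
apply: val_inj; apply: toggles_fun (phiP (phi T)) _.
exact/toggles_sym/phiP.
Qed.

Lemma card_even_improper :
  #|[set T : nctree n | even_tree T & improper_tree T]| =
  #|[set T : nctree n | odd_tree T & improper_tree T]|.
Proof.
have [phi [phiK phi_odd]] := toggle_exists.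
pose S b := [set T : {T : nctree n | improper_tree T} | odd #|descents (val T)| == b].
have cardS b : #|S b| = #|[set T : nctree n | (odd #|descents T| == b) && improper_tree T]|.
  rewrite -(card_imset _ val_inj); apply: eq_card => T; rewrite inE.
  apply/imsetP/andP => [[U]|[oT impT]].
    by rewrite inE => oU ->; split=> //; apply: valP.
  by exists (Sub T impT); rewrite ?inE.
(* The involution [phi] exchanges the two parity classes. *)
have eqS : #|S false| = #|S true|.
  rewrite -(card_imset _ (can_inj phiK)); apply: eq_card => T.
  rewrite -(phiK T) mem_imset ?inE; last exact: can_inj phiK.
  by rewrite (phi_odd (phi T)) (phi_odd T); case: (odd #|_|).
transitivity #|S false|; last rewrite eqS; rewrite cardS; apply: eq_card => T;
  by rewrite !inE /even_tree /odd_tree; case: odd.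
Qed.

(** A proper tree is even, so odd trees are all improper and balance the even improper ones; the
    even trees left over are the proper trees. *)
Lemma num_even_split : num_even n = num_proper n + num_odd n.
Proof.
have odd_improper : [set T : nctree n | odd_tree T] =
    [set T : nctree n | odd_tree T & improper_tree T].
  apply/setP=> T; rewrite !inE; case: (boolP (odd_tree T)) => //= oT.
  by apply/esym/negP => /proper_tree_even; rewrite /even_tree -/(odd_tree T) oT.
rewrite /num_odd odd_improper -card_even_improper /num_even /num_proper.
rewrite -(cardsID [set T : nctree n | proper_tree T]); congr (_ + _).
  apply: eq_card => T; rewrite !inE andbC.
  by case: (boolP (proper_tree T)) => //= /proper_tree_even.
by apply: eq_card => T; rewrite !inE andbC.
Qed.

End Toggle.

Local Open Scope ring_scope.

Theorem theorem2p2 (n : nat) (n_ge1 : (1 <= n)%N) :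
  (exists phi : {T : nctree n | improper_tree T} ->
                {T : nctree n | improper_tree T},
     involutive phi /\
     forall T : {T : nctree n | improper_tree T},
       odd #|descents (val (phi T))| = ~~ odd #|descents (val T)|) /\
  (num_even n)%:Z - (num_odd n)%:Z = (num_proper n)%:Z.
Proof. by split; [exact: toggle_exists | rewrite num_even_split; lia]. Qed.
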